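(* Let $k\ge 2$ be an integer and let $\vec b=(b_0,b_1,b_2,\dots)$ be a sequence of integers. The $k$-dimensional $k$-bounded weighted Catalan numbers satisfy, for all $n\ge 2$, $$C^{\vec b}_{k,k,n}=(b_0+(k-1)b_1)\,C^{\vec b}_{k,k,n-1}.$$
   Context: A $k$-dimensional Balanced ballot path of $kn$ steps is a lattice path in $\mathbb{Z}^k$ from $(0,\dots,0)$ to $(n,\dots,n)$ with $kn$ steps, each step being one of the standard unit vectors $\vec e_1,\dots,\vec e_k$, such that every point $x=(x_1,\dots,x_k)$ on the path satisfies $x_1\ge x_2\ge\cdots\ge x_k$. An up-step is a step $\vec e_1$. The height of a point $x\in\mathbb{Z}^k$ is $h_k(x)=(k-1)x_1-\sum_{i=2}^k x_i$. The weight of such a path $P$ with respect to $\vec b$ is $wt_{\vec b}(P)=b_{h_1}b_{h_2}\cdots b_{h_n}$, where $h_i$ is the height of the starting point of the $i$-th up-step of $P$. The $k$-dimensional $s$-bounded weighted Catalan number is $C^{\vec b}_{k,s,n}=\sum_P wt_{\vec b}(P)$, the sum over all $k$-dimensional Balanced ballot paths $P$ of $kn$ steps all of whose points $x$ satisfy $h_k(x)\le s$; here $s=k$. *)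

(* Defs.v *)
From HB Require Import structures.
From mathcomp Require Import all_boot all_order all_algebra.
Set Implicit Arguments.
Unset Strict Implicit.
Unset Printing Implicit Defensive.
Import Order.TTheory GRing.Theory Num.Theory.
Local Open Scope ring_scope.

(* A lattice path is given by its sequence of steps: the index i : 'I_k stands
   for the unit vector \vec e_{i+1}, so the index of value 0 is the up-step. *)
Definition is_up (k : nat) (i : 'I_k) : bool := (i == 0 :> nat)%N.

Definition point (k m : nat) (P : m.-tuple 'I_k) (t : nat) : 'rV[int]_k :=
  \sum_(i <- take t P) delta_mx 0 i.

(* For 0 < k the first sum has x_1 as its only term; writing it as a sum avoids
   having to produce an inhabitant of 'I_k. *)
Definition height (k : nat) (x : 'rV[int]_k) : int :=
  (k%:Z - 1) * (\sum_(i < k | is_up i) x 0 i)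
  - \sum_(i < k | ~~ is_up i) x 0 i.

Definition balanced_ballot (k n : nat) (P : (k * n).-tuple 'I_k) : bool :=
  (point P (k * n) == const_mx n%:Z) &&
  [forall t : 'I_(k * n).+1, forall i : 'I_k, forall j : 'I_k,
     (i <= j)%N ==> (point P t 0 j <= point P t 0 i)].

Definition bounded (k m s : nat) (P : m.-tuple 'I_k) : bool :=
  [forall t : 'I_m.+1, height (point P t) <= s%:Z].

(* Heights along a ballot path are nonnegative, so `|_|%N only converts them
   from int to nat. *)
Definition weight (b : nat -> int) (k m : nat) (P : m.-tuple 'I_k) : int :=
  \prod_(t < m | is_up (tnth P t)) b `|height (point P t)|%N.

Definition wcatalan (b : nat -> int) (k s n : nat) : int :=
  \sum_(P : (k * n).-tuple 'I_k | balanced_ballot P && bounded s P) weight b P.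

(* Main.v *)
Require Import Defs.
From mathcomp Require Import all_boot all_order all_algebra.
From mathcomp Require Import zify ring.
Import Order.TTheory GRing.Theory Num.Theory.
Local Open Scope ring_scope.

(** An up-step raises the height by k - 1 and every other step lowers it by 1,
    so under the bound k an up-step can only start at height 0 or 1.  On the
    ballot cone height 0 means (a-1, ..., a-1), and height 1 means
    (a-1, ..., a-1, a-2).  Consider the part of a path from just before its
    last up-step to the end (a, ..., a).  The last step is forced, since
    (a, ..., a, a-1) is the only ballot point from which (a, ..., a) is
    reached.
    - From (a-1, ..., a-1) the up-step has weight b_0, and the coordinates
      2, ..., k-1 must then be raised in this order: one way.
    - From (a-1, ..., a-1, a-2) the up-step has weight b_1, the coordinates
      2, ..., k-1 must again be raised in order, and the last coordinate is
      raised from a-2 to a-1 once, at any of k - 1 moments: k - 1 ways.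
    The paths to (a-1, ..., a-1, a-2) are, up to one forced step of weight 1,
    the paths to (a-1, ..., a-1), so both cases are governed by the same total
    weight, which gives the factor b_0 + (k-1) b_1.

    The argument is run as a transfer-matrix computation.  [wpaths b s m x] is
    the total weight of the admissible paths of m steps ending at x, and
    [wpathsS] is its recursion on the last step.  All the relevant points have
    the shape [stair].  The inequality [tight] is preserved by admissible steps;
    together with the ballot condition it excludes all but two predecessors of a
    stair point, so the recursion reduces to two terms ([wpaths_stair]).
    Summing it along the row of stairs with last coordinate a-2
    ([wpaths_lagging]), and then along the row with last coordinate a-1
    ([wpaths_leading]), counts the k - 1 insertion moments.  For n = 1 the
    relation breaks down: the second case would start from (0, ..., 0, -1),
    which no path visits, while the origin carries weight 1. *)

(** * Weighted path sums and the recursion on the last step *)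

Definition valid_point {k : nat} (s : nat) (x : 'rV[int]_k) : bool :=
  [forall i : 'I_k, forall j : 'I_k, (i <= j)%N ==> (x 0 j <= x 0 i)]
  && (height x <= s%:Z).

Definition confined {k m : nat} (s : nat) (P : m.-tuple 'I_k) : bool :=
  [forall t : 'I_m.+1, valid_point s (point P t)].

Definition wpaths (b : nat -> int) {k : nat} (s m : nat) (x : 'rV[int]_k) : int :=
  \sum_(P : m.-tuple 'I_k | confined s P && (point P m == x)) weight b P.

(** The factor contributed to the weight of a path by the step i from x. *)
Definition step_weight (b : nat -> int) {k : nat} (x : 'rV[int]_k) (i : 'I_k) : int :=
  if is_up i then b `|height x|%N else 1.

Lemma valid_pointP {k s : nat} {x : 'rV[int]_k} :
  reflect ((forall i j : 'I_k, (i <= j)%N -> x 0 j <= x 0 i) /\ height x <= s%:Z)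
          (valid_point s x).
Proof.
apply: (iffP andP) => -[Hb Hh]; split=> //.
  by move=> i j; move/forallP/(_ i)/forallP/(_ j)/implyP: Hb.
by apply/forallP => i; apply/forallP => j; apply/implyP; apply: Hb.
Qed.

Lemma wcatalan_wpaths (b : nat -> int) (k s n : nat) :
  wcatalan b k s n = wpaths b s (k * n) (const_mx n%:Z : 'rV[int]_k).
Proof.
apply: eq_bigl => P; rewrite /balanced_ballot [in RHS]andbC -andbA; congr andb.
apply/andP/forallP => [[/forallP Hb /forallP Hh] t | H].
  by rewrite /valid_point Hb Hh.
by split; apply/forallP => t; case/andP: (H t).
Qed.

Lemma wpaths_invalid (b : nat -> int) {k s : nat} (m : nat) {x : 'rV[int]_k} :
  ~~ valid_point s x -> wpaths b s m x = 0.
Proof.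
move=> Hx; rewrite /wpaths big1 // => P /andP[/forallP/(_ ord_max) /=].
by move=> HP /eqP Ex; rewrite Ex (negbTE Hx) in HP.
Qed.

Lemma wpaths_start (b : nat -> int) {k s : nat} {x : 'rV[int]_k} :
  x != 0 -> wpaths b s 0 x = 0.
Proof.
move=> Hx; rewrite /wpaths big1 // => P /andP[_].
by rewrite /point take0 big_nil eq_sym (negbTE Hx).
Qed.

Lemma point_rcons {k m : nat} (P : m.-tuple 'I_k) (i : 'I_k) (t : nat) :
  (t <= m)%N -> point (rcons_tuple P i) t = point P t.
Proof. by move=> tm; rewrite /point /= -cats1 takel_cat ?size_tuple. Qed.

Lemma point_rcons_last {k m : nat} (P : m.-tuple 'I_k) (i : 'I_k) :
  point (rcons_tuple P i) m.+1 = point P m + delta_mx 0 i.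
Proof.
rewrite /point !take_oversize ?size_tuple //=.
by rewrite -cats1 big_cat big_seq1.
Qed.

Lemma confined_rcons {k m : nat} (s : nat) (P : m.-tuple 'I_k) (i : 'I_k) :
  confined s (rcons_tuple P i) =
  confined s P && valid_point s (point P m + delta_mx 0 i).
Proof.
apply/forallP/andP => [H | [/forallP H Hl] t].
  split; last by rewrite -point_rcons_last; apply: (H ord_max).
  apply/forallP => t; have tm : (t <= m)%N by rewrite -ltnS.
  by rewrite -(point_rcons P i t tm); apply: (H (widen_ord (leqnSn _) t)).
have [tm | tm] := leqP t m.
  by rewrite point_rcons //; apply: (H (Ordinal (tm : (t < m.+1)%N))).
have -> : t = m.+1 :> nat by apply/eqP; rewrite eqn_leq tm andbT -ltnS.
by rewrite point_rcons_last.
Qed.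

Lemma weight_rcons (b : nat -> int) {k m : nat} (P : m.-tuple 'I_k) (i : 'I_k) :
  weight b (rcons_tuple P i) = step_weight b (point P m) i * weight b P.
Proof.
rewrite /weight big_mkcond big_ord_recr /= mulrC; congr (_ * _).
  rewrite (tnth_nth i) /= nth_rcons size_tuple ltnn eqxx.
  by rewrite point_rcons.
rewrite [RHS]big_mkcond; apply: eq_bigr => t _.
rewrite !(tnth_nth i) /= nth_rcons size_tuple ltn_ord.
by rewrite point_rcons // ltnW.
Qed.

(** Removing the last step i is a bijection from paths of m + 1 steps ending at
    x to pairs of a step i and a path of m steps ending at x - e_i. *)
Lemma wpathsS (b : nat -> int) {k s : nat} (m : nat) {x : 'rV[int]_k} :
  valid_point s x ->
  wpaths b s m.+1 x =
  \sum_i step_weight b (x - delta_mx 0 i) i * wpaths b s m (x - delta_mx 0 i).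
Proof.
move=> Hx.
pose f (p : 'I_k * m.-tuple 'I_k) := rcons_tuple p.2 p.1.
have f_inj : injective f.
  move=> [i P] [j Q] /(congr1 val) /= /rcons_inj [PQ ->].
  by congr pair; apply: val_inj.
(* Surjectivity comes for free from counting: both sides have k^(m+1) elements. *)
have f_bij : bijective f.
  by apply: inj_card_bij => //; rewrite card_prod !card_tuple expnS.
rewrite /wpaths (reindex f) /=; last exact: onW_bij.
under [RHS]eq_bigr => i _ do rewrite big_distrr /=.
rewrite pair_big_dep /=; apply: eq_big => [[i P] | [i P]] /=.
  have -> : (point P m == x - delta_mx 0 i) = (point P m + delta_mx 0 i == x).
    by rewrite eq_sym subr_eq eq_sym.
  rewrite confined_rcons point_rcons_last -andbA; congr andb.
  by case: eqP => [->|]; rewrite ?andbF ?Hx.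
move=> /andP[_]; rewrite point_rcons_last => /eqP <-.
by rewrite addrK weight_rcons.
Qed.

(** * Reachable points stay close to the diagonal *)

Lemma heightE {K : nat} (x : 'rV[int]_K.+1) : height x = \sum_i (x 0 0 - x 0 i).
Proof.
rewrite sumrB sumr_const card_ord /height [X in _ = _ - X](bigID (@is_up _)) /=.
rewrite -[\sum_(i < K.+1 | is_up i) x 0 i]/(\sum_(i < K.+1 | i == 0) x 0 i).
rewrite big_pred1_eq -mulr_natl; ring.
Qed.

Lemma stepE {K : nat} (x : 'rV[int]_K) (i l : 'I_K) :
  (x - delta_mx 0 i) 0 l = x 0 l - (l == i)%:R.
Proof. by rewrite !mxE eqxx. Qed.

(** An up-step starts at height at most 1, so just after it at most one
    coordinate other than the first lags by 2, and none by more; later steps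
    only reduce the lags.  Only the lag of the last coordinate matters here:
    taking i = 0 gives x_1 - x_k <= 2, and taking 0 < i < k - 1 (numbering from
    0) excludes that the last coordinate and coordinate i both lag by 2. *)
Definition tight {K : nat} (x : 'rV[int]_K.+2) : Prop :=
  forall i : 'I_K.+2, (i < K.+1)%N ->
    2 * x 0 0 - x 0 i - x 0 ord_max <= 2 + (i != 0)%:R.

(** The height is a sum of nonnegative lags, so it dominates any two of them. *)
Lemma height_two {K : nat} (x : 'rV[int]_K.+2) (i : 'I_K.+2) :
  (forall l, x 0 l <= x 0 0) -> (i < K.+1)%N ->
  2 * x 0 0 - x 0 i - x 0 ord_max <= height x.
Proof.
move=> Hx Hi; have ne : i != ord_max by rewrite -val_eqE /= neq_ltn Hi.
rewrite heightE (bigD1 ord_max) //= (bigD1 i) //=.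
have : 0 <= \sum_(l < K.+2 | (l != ord_max) && (l != i)) (x 0 0 - x 0 l).
  by apply: sumr_ge0 => l _; rewrite subr_ge0.
move: (\sum_(l < _ | _) _) => S; lia.
Qed.

Lemma height_step_up {K : nat} (x : 'rV[int]_K.+1) :
  height (x - delta_mx 0 0) = height x - K%:Z.
Proof.
rewrite !heightE !big_ord_recl !subrr !add0r -[K in K%:Z]card_ord.
rewrite -natz -sumr_const -sumrB; apply: eq_bigr => i _.
rewrite !stepE /=; ring.
Qed.

(** Points off the tight region carry no weight.  The bound on the height is
    used just after an up-step, where it forces the point before that step to
    have height at most 1. *)
Lemma wpaths_not_tight (b : nat -> int) {K : nat} (m : nat) (x : 'rV[int]_K.+2) :
  ~ tight x -> wpaths b K.+2 m x = 0.
Proof.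
elim: m x => [|m IH] x Hx.
  apply: wpaths_start; apply/eqP => E; apply: Hx => i _.
  by rewrite E !mxE; case: (i != 0).
have [Vx | Vx] := boolP (valid_point K.+2 x); last exact: wpaths_invalid.
rewrite wpathsS // big1 // => i _; apply/eqP; rewrite mulf_eq0; apply/orP; right.
apply/eqP; set y := x - _.
have [/valid_pointP[By _] | Vy] := boolP (valid_point K.+2 y); last first.
  exact: wpaths_invalid.
apply: IH => Ty; apply: Hx => l Hl.
have [i0 | i0] := eqVneq i 0.
  have hx : height y <= 1.
    rewrite /y i0 height_step_up; case/valid_pointP: Vx => _; lia.
  have := height_two y l (fun l => By 0 l isT) Hl.
  rewrite /y i0 !stepE eqxx /= in hx *.
  case: (l =P 0) => [->|_] /=; lia.
have := Ty l Hl; rewrite /y !stepE eq_sym (negbTE i0) /=.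
case: (l == i); case: (ord_max == i); lia.
Qed.

(** * The recursion on stair points *)

(** The points of a path between two visits to the diagonal: in the phase that
    raises the coordinates from a - 1 to a, the first j have been raised, and
    the last coordinate c evolves on its own.  For j <= K + 1 this point has
    first j coordinates a; j = 0 is the point before the up-step, and
    j = K + 1 with c = a - 1 is the last point before the diagonal. *)
Definition stair (K : nat) (a c : int) (j : nat) : 'rV[int]_K.+2 :=
  \row_(i < K.+2) (if (i < j)%N then a else if (i < K.+1)%N then a - 1 else c).

Lemma stair_height0 (K : nat) (a c : int) : height (stair K a c 0) = a - 1 - c.
Proof.
rewrite heightE big_ord_recr /= !mxE /= ltnn big1 ?add0r // => i _.
by rewrite !mxE /= ltn_ord subrr.
Qed.

(** The last coordinate lags by at most 2, the first by 0 and each of the K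
    others by at most 1, which totals at most the bound K + 2. *)
Lemma stair_valid (K : nat) (a c : int) (j : nat) :
  (j <= K)%N -> a - 2 <= c <= a - 1 -> valid_point K.+2 (stair K a c j.+1).
Proof.
move=> jK /andP[c1 c2]; apply/valid_pointP; split=> [i l il |].
  by rewrite !mxE; repeat case: ifP => ?; lia.
have x0 : stair K a c j.+1 0 0 = a by rewrite mxE.
have xl : stair K a c j.+1 0 ord_max = c by rewrite mxE /= ltnn ltnS ltnNge jK.
rewrite heightE big_ord_recr big_ord_recl /= x0 xl.
rewrite [widen_ord _ _](_ : _ = 0); last exact: val_inj.
rewrite x0 subrr add0r.
suff : \sum_(i < K) (a - stair K a c j.+1 0 (widen_ord (leqnSn K.+1) (lift 0 i)))
    <= K%:Z by move: (\sum_(i < K) _) => S; lia.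
rewrite -[leRHS]natz -[K in K%:R]card_ord -sumr_const; apply: ler_sum => i _.
rewrite !mxE /= /bump /=; have := ltn_ord i; repeat case: ifP => ?; lia.
Qed.

(** A stair point is entered by raising either the j-th coordinate in order or
    the last one.  Entering through an earlier coordinate would leave a point
    outside the ballot cone.  Entering through a later one, from the value
    a - 2, leaves that cone if c = a - 1 and is not tight if c = a - 2. *)
Lemma wpaths_stair (b : nat -> int) (K m : nat) (a c : int) (j : nat) :
  (j <= K)%N -> a - 2 <= c <= a - 1 ->
  wpaths b K.+2 m.+1 (stair K a c j.+1) =
  (if j == 0%N then b `|(a - 1 - c)%R|%N else 1) * wpaths b K.+2 m (stair K a c j)
  + wpaths b K.+2 m (stair K a (c - 1) j.+1).
Proof.
move=> jK Hc; rewrite wpathsS; last exact: stair_valid.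
have jo : (inord j : 'I_K.+2) = j :> nat by rewrite inordK //; lia.
have ne : inord j != ord_max :> 'I_K.+2 by rewrite -val_eqE /= jo; lia.
have Ej : stair K a c j.+1 - delta_mx 0 (inord j) = stair K a c j.
  apply/rowP => l; rewrite stepE !mxE -val_eqE /= jo; repeat case: ifP => ?; lia.
have El : stair K a c j.+1 - delta_mx 0 ord_max = stair K a (c - 1) j.+1.
  apply/rowP => l; rewrite stepE !mxE -val_eqE /=; have := ltn_ord l.
  repeat case: ifP => ?; lia.
rewrite (bigD1 (inord j)) //= (bigD1 ord_max) ?[ord_max == _]eq_sym //= Ej El.
rewrite big1 ?addr0 => [|i /andP[ij il]].
  congr (_ * _ + _); last by rewrite /step_weight /is_up mul1r.
  rewrite /step_weight /is_up jo; case: eqP => // ->.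
  by rewrite stair_height0.
have {}ij : i != j :> nat by rewrite -jo val_eqE.
have {}il : (i < K.+1)%N by move: il (ltn_ord i); rewrite -val_eqE /=; lia.
apply/eqP; rewrite mulf_eq0; apply/orP; right; apply/eqP.
have [lt_ij | le_ji] := ltnP i j.
  apply: wpaths_invalid; apply/valid_pointP => -[/(_ i (inord j)) + _].
  rewrite jo !stepE !mxE -!val_eqE /= jo eqxx [_ == val i]eq_sym (negbTE ij) /=.
  repeat case: ifP => ?; lia.
have {}ij : (j < i)%N by lia.
have ne_li : (K.+1 == i) = false by lia.
(* Here i had the value a - 2 before the step and the last coordinate c. *)
have [cE | cE] : c = a - 1 \/ c = a - 2 by lia.
  apply: wpaths_invalid; apply/valid_pointP => -[/(_ i ord_max) + _].
  rewrite !stepE !mxE -!val_eqE /= eqxx ne_li /=; repeat case: ifP => ?; lia.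
apply: wpaths_not_tight => /(_ i il).
rewrite !stepE !mxE -!val_eqE /= eqxx ne_li /=; repeat case: ifP => ?; lia.
Qed.

(** The diagonal can only be entered by raising the last coordinate. *)
Lemma wpaths_diagonal (b : nat -> int) (K m : nat) (a : int) :
  wpaths b K.+2 m.+1 (const_mx a : 'rV[int]_K.+2) =
  wpaths b K.+2 m (stair K a (a - 1) K.+1).
Proof.
rewrite wpathsS; last first.
  apply/valid_pointP; split=> [i j _ |]; first by rewrite !mxE.
  by rewrite heightE big1 // => i _; rewrite !mxE subrr.
rewrite (bigD1 ord_max) //= big1 ?addr0 => [|i ne].
  rewrite /step_weight /is_up /= mul1r; congr wpaths.
  apply/rowP => l; rewrite stepE !mxE -val_eqE /=; have := ltn_ord l.
  repeat case: ifP => ?; lia.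
rewrite wpaths_invalid ?mulr0 //; apply/valid_pointP => -[/(_ i ord_max) + _].
by rewrite !stepE !mxE eqxx [ord_max == i]eq_sym (negbTE ne) -ltnS ltn_ord; lia.
Qed.

(** While the last coordinate still is a - 2, there is only one way to go on:
    a last coordinate equal to a - 3 would have a lag of 3, which is not tight. *)
Lemma wpaths_lagging (b : nat -> int) (K m : nat) (a : int) (j : nat) :
  (j <= K)%N ->
  wpaths b K.+2 (m + j.+1) (stair K a (a - 2) j.+1) =
  b 1%N * wpaths b K.+2 m (stair K a (a - 2) 0).
Proof.
have dead p i : (i <= K)%N -> wpaths b K.+2 p (stair K a (a - 2 - 1) i.+1) = 0.
  move=> iK; apply: wpaths_not_tight => /(_ 0 isT).
  rewrite !mxE /= ltnn ltnS ltnNge iK /=; lia.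
have range_a2 : a - 2 <= a - 2 <= a - 1 by lia.
elim: j => [|j IH] jK; rewrite addnS wpaths_stair ?dead ?addr0 //=.
  by rewrite addn0 (_ : a - 1 - (a - 2) = 1) //; lia.
by rewrite mul1r IH // ltnW.
Qed.

(** Either the last coordinate was a - 1 before the up-step, or it was raised
    from a - 2 to a - 1 at one of j + 1 moments after it; each of these moments
    contributes the same amount, by the previous lemma. *)
Lemma wpaths_leading (b : nat -> int) (K m : nat) (a : int) (j : nat) :
  (j <= K)%N ->
  wpaths b K.+2 (m.+1 + j.+1) (stair K a (a - 1) j.+1) =
  b 0%N * wpaths b K.+2 m.+1 (stair K a (a - 1) 0)
  + j.+1%:R * (b 1%N * wpaths b K.+2 m (stair K a (a - 2) 0)).
Proof.
have a2 : a - 1 - 1 = a - 2 by lia.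
have range_a1 : a - 2 <= a - 1 <= a - 1 by lia.
have lag i : (i <= K)%N -> wpaths b K.+2 (m.+1 + i) (stair K a (a - 2) i.+1) =
    b 1%N * wpaths b K.+2 m (stair K a (a - 2) 0).
  by rewrite addSnnS; apply: wpaths_lagging.
elim: j => [|j IH] jK; rewrite addnS wpaths_stair // a2 lag //=.
  by rewrite addn0 subrr mul1r.
by rewrite IH 1?ltnW // -[in RHS]natr1; ring.
Qed.

Theorem theorem4p1 (k : nat) (hk : (2 <= k)%N) (b : nat -> int)
    (n : nat) (hn : (2 <= n)%N) :
  wcatalan b k k n = (b 0%N + (k%:Z - 1) * b 1%N) * wcatalan b k k (n - 1)%N.
Proof.
case: k hk => [|[|K]] // _; case: n hn => [|[|n]] // _.
rewrite subn1 /= !wcatalan_wpaths.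
(* [m] is the number of steps of a path to the point before (n+1, ..., n+1). *)
pose m := (K.+1 + K.+2 * n)%N.
have -> : (K.+2 * n.+2 = (m.+1 + K.+1).+1)%N by rewrite /m; lia.
have -> : (K.+2 * n.+1 = m.+1)%N by rewrite /m; lia.
rewrite wpaths_diagonal wpaths_leading //.
have -> : stair K n.+2%:Z (n.+2%:Z - 1) 0 = const_mx n.+1%:Z.
  apply/rowP => i; rewrite !mxE /=; case: ifP => _; lia.
(* The starting point of height 1 of the last round is itself the last point
   before the previous diagonal point. *)
have -> : stair K n.+2%:Z (n.+2%:Z - 2) 0 = stair K n.+1%:Z (n.+1%:Z - 1) K.+1.
  apply/rowP => i; rewrite !mxE /=; repeat case: ifP => ?; lia.
rewrite -wpaths_diagonal natz; ring.
Qed.
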